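(* Let $\mathcal{X}$ be a nonempty finite set, and let $\{\mathcal{E}_x\}_{x\in\mathcal{X}}$ be quantum channels from operators on a nonzero finite-dimensional Hilbert space $\mathcal{H}_A$ to operators on a finite-dimensional Hilbert space $\mathcal{H}_B$. For every initial pure state $\rho^{(0)}$ on $\mathcal{H}_A$, the alternating optimization algorithm described in the context (with arbitrary choices of maximizers and of top eigenvectors) converges: the sequence of objective values $(V^{(k)})_{k\ge1}$ it generates converges, so that for every tolerance $\epsilon>0$ the stopping criterion $|V^{(k)}-V^{(k-1)}|<\epsilon$ is met after finitely many iterations.
   Context: A quantum channel is a completely positive trace-preserving linear map. The adjoint $\mathcal{E}^\dagger$ of a channel $\mathcal{E}$ is the linear map defined by $\mathrm{Tr}(B\,\mathcal{E}(A))=\mathrm{Tr}(\mathcal{E}^\dagger(B)A)$ for all operators $A$ on $\mathcal{H}_A$ and $B$ on $\mathcal{H}_B$. A POVM indexed by $\mathcal{X}$ on $\mathcal{H}_B$ is a family $\{M_x\}_{x\in\mathcal{X}}$ with $M_x\ge0$ and $\sum_xM_x=I$. A pure state is an operator $|v\rangle\langle v|$ with $v$ a unit vector. The algorithm is intended for the joint maximization of $\sum_{x}\mathrm{Tr}(\mathcal{E}_x(\rho)M_x)$ over density operators $\rho$ on $\mathcal{H}_A$ and POVMs $\{M_x\}_{x\in\mathcal{X}}$ on $\mathcal{H}_B$. Start from a pure state $\rho^{(0)}$ on $\mathcal{H}_A$ and $V^{(0)}=0$. For $k=1,2,\dots$: (A) Let $\{M_x^{(k)}\}_{x\in\mathcal{X}}$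 be a maximizer of $\sum_{x\in\mathcal{X}}\mathrm{Tr}(\mathcal{E}_x(\rho^{(k-1)})M_x)$ over all POVMs $\{M_x\}_{x\in\mathcal{X}}$ on $\mathcal{H}_B$. (B) Let $R^{(k)}=\sum_{x\in\mathcal{X}}\mathcal{E}_x^\dagger(M_x^{(k)})$, let $\lambda_{\max}$ be its largest eigenvalue and $|v_{\max}\rangle$ a corresponding unit eigenvector; set $\rho^{(k)}=|v_{\max}\rangle\langle v_{\max}|$ and $V^{(k)}=\lambda_{\max}$. The algorithm stops at the first $k$ for which $|V^{(k)}-V^{(k-1)}|<\epsilon$, where $\epsilon>0$ is the given tolerance; the sequence $(V^{(k)})$ refers to running the iteration without stopping. *)

(* Defs.v *)
From HB Require Import structures.
From mathcomp Require Import all_boot all_order all_algebra.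
From mathcomp Require Import complex.
From mathcomp Require Import all_classical all_reals all_analysis.
Import Order.TTheory GRing.Theory Num.Theory numFieldNormedType.Exports.

Set Implicit Arguments.
Unset Strict Implicit.
Unset Printing Implicit Defensive.

Local Open Scope ring_scope.
Local Open Scope sesquilinear_scope.
Local Open Scope complex_scope.

(* Operators on the Hilbert space C^n are matrices 'M[R[i]]_n, vectors (kets)
   are columns 'cV[R[i]]_n, and A ^t* is the conjugate transpose.  On R[i],
   x <= y means that y - x is a nonnegative real. *)

Section QuantumDefs.
Context {R : realType}.
Local Notation C := R[i].

(* Over C, nonnegativity of <v|A|v> for all v forces A to be Hermitian. *)
Definition psdmx (n : nat) (A : 'M[C]_n) : Prop :=
  forall v : 'cV[C]_n, 0 <= (v ^t* *m A *m v) 0 0.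

Definition unit_vector (n : nat) (v : 'cV[C]_n) : Prop :=
  (v ^t* *m v) 0 0 = 1.

Definition ketbra (n : nat) (v : 'cV[C]_n) : 'M[C]_n := v *m v ^t*.

Definition pure_state (n : nat) (rho : 'M[C]_n) : Prop :=
  exists2 v : 'cV[C]_n, unit_vector v & rho = ketbra v.

(* id_k (x) E, acting on k x k block matrices with blocks in 'M_n. *)
Definition ampliation (k n m : nat) (E : 'M[C]_n -> 'M[C]_m)
    (A : 'M[C]_(\sum_(i < k) n)) : 'M[C]_(\sum_(i < k) m) :=
  \mxblock_(i < k, j < k) E (submxblock A i j).

Definition completely_positive (n m : nat) (E : 'M[C]_n -> 'M[C]_m) : Prop :=
  forall (k : nat) (A : 'M[C]_(\sum_(i < k) n)),
    psdmx A -> psdmx (ampliation E A).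

Definition trace_preserving (n m : nat) (E : 'M[C]_n -> 'M[C]_m) : Prop :=
  forall A : 'M[C]_n, \tr (E A) = \tr A.

Definition quantum_channel (n m : nat)
    (E : {linear 'M[C]_n -> 'M[C]_m}) : Prop :=
  completely_positive E /\ trace_preserving E.

(* The entries of E^dagger(B) are forced by the defining identity
   tr (B E(A)) = tr (E^dagger(B) A) at A = |j><i|; see adjointP. *)
Definition adjoint (n m : nat) (E : 'M[C]_n -> 'M[C]_m)
    (B : 'M[C]_m) : 'M[C]_n :=
  \matrix_(i, j) \tr (B *m E (delta_mx j i)).

Lemma tr_mul_delta (n : nat) (F : 'M[C]_n) (i j : 'I_n) :
  \tr (F *m delta_mx j i) = F i j.
Proof.
rewrite /mxtrace (bigD1 i) //= big1 ?addr0 => [|k ki].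
  rewrite mxE (bigD1 j) //= mxE !eqxx mulr1 big1 ?addr0 // => l lj.
  by rewrite mxE (negbTE lj) mulr0.
rewrite mxE big1 // => l _.
by rewrite mxE (negbTE ki) andbF mulr0.
Qed.

Lemma adjointP (n m : nat) (E : {linear 'M[C]_n -> 'M[C]_m})
    (F : 'M[C]_m -> 'M[C]_n) :
  (forall A B, \tr (B *m E A) = \tr (F B *m A)) <-> F =1 adjoint E.
Proof.
split=> [FE B|FE A B].
  by apply/matrixP => i j; rewrite mxE FE tr_mul_delta.
rewrite FE {1 2}[A]matrix_sum_delta !(linear_sum, mulmx_sumr) /=.
apply: eq_bigr => i _; rewrite !(linear_sum, mulmx_sumr) /=.
apply: eq_bigr => j _.
by rewrite linearZ -!scalemxAr !mxtraceZ tr_mul_delta mxE.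
Qed.

Section Algorithm.
Variables (X : finType) (n m : nat) (E : X -> {linear 'M[C]_n -> 'M[C]_m}).

Definition povm (M : X -> 'M[C]_m) : Prop :=
  (forall x, psdmx (M x)) /\ \sum_x M x = 1%:M.

Definition objective (rho : 'M[C]_n) (M : X -> 'M[C]_m) : C :=
  \sum_x \tr (E x rho *m M x).

Definition optimal_povm (rho : 'M[C]_n) (M : X -> 'M[C]_m) : Prop :=
  povm M /\ forall N, povm N -> objective rho N <= objective rho M.

Definition pullback (M : X -> 'M[C]_m) : 'M[C]_n :=
  \sum_x adjoint (E x) (M x).

Definition largest_eigenvalue (A : 'M[C]_n) (a : C) : Prop :=
  eigenvalue A a /\ forall b, eigenvalue A b -> b <= a.

(* The infinite run of the iteration, without stopping; M 0 is unused. *)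
Definition alternating_run (rho : nat -> 'M[C]_n) (M : nat -> X -> 'M[C]_m)
    (V : nat -> R) : Prop :=
  [/\ pure_state (rho 0%N),
      V 0%N = 0 &
      forall k : nat,
        [/\ optimal_povm (rho k) (M k.+1),
            largest_eigenvalue (pullback (M k.+1)) (V k.+1)%:C &
            exists v : 'cV[C]_n,
              [/\ unit_vector v,
                  pullback (M k.+1) *m v = (V k.+1)%:C *: v &
                  rho k.+1 = ketbra v]]].

End Algorithm.
End QuantumDefs.

(* Main.v *)
Require Import Defs.
From HB Require Import structures.
From mathcomp Require Import all_boot all_order all_algebra.
From mathcomp Require Import complex.
From mathcomp Require Import all_classical all_reals all_analysis.
Import Order.TTheory GRing.Theory Num.Theory numFieldNormedType.Exports.

Local Open Scope classical_set_scope.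
Local Open Scope ring_scope.

(** Since rho_k projects onto a top eigenvector of the pullback R_k, one has
    V_k = tr (R_k rho_k) <= tr (R_(k+1) rho_k) <= V_(k+1), by optimality of
    the POVM and then by the Rayleigh bound for the top eigenvalue.  Each
    tr (E_x(rho) M_x) is at most tr (E_x(rho)) = 1, so V is bounded by the
    number of outcomes, and a bounded monotone sequence converges. *)

Section PositiveMatrices.
Context {R : realType}.
Local Notation C := R[i].
Local Open Scope sesquilinear_scope.

Lemma trmxC_mul (m n p : nat) (A : 'M[C]_(m, n)) (B : 'M[C]_(n, p)) :
  (A *m B) ^t* = B ^t* *m A ^t*.
Proof. by rewrite trmx_mul map_mxM. Qed.

Lemma mxtrace_ketbra (n : nat) (A : 'M[C]_n) (v : 'cV[C]_n) :
  \tr (A *m ketbra v) = (v ^t* *m A *m v) 0 0.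
Proof.
by rewrite /ketbra mulmxA mxtrace_mulC mulmxA /mxtrace big_ord1.
Qed.

Lemma psdmx_congr (m n : nat) (A : 'M[C]_m) (B : 'M[C]_(m, n)) :
  psdmx A -> psdmx (B ^t* *m A *m B).
Proof.
by move=> Apos v; have := Apos (B *m v); rewrite trmxC_mul !mulmxA.
Qed.

Lemma psdmx_ketbra (n : nat) (v : 'cV[C]_n) : psdmx (ketbra v).
Proof.
(* The form factors as [z ^t* *m z] with [z = v ^t* *m w], a squared modulus. *)
move=> w; rewrite /ketbra mulmxA -mulmxA -[w ^t* *m v]trmxCK trmxC_mul trmxCK.
by rewrite mxE big_ord1 !mxE mulrC mul_conjC_ge0.
Qed.

Lemma psdmx_sum (I : finType) (n : nat) (A : I -> 'M[C]_n) :
  (forall i, psdmx (A i)) -> psdmx (\sum_i A i).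
Proof.
move=> Apos v; rewrite mulmx_sumr mulmx_suml summxE.
by apply: sumr_ge0 => i _; apply: Apos.
Qed.

(** The kets are the adjoints of the rows of the unitary that diagonalizes [A]. Giving [d i] as a
    value of the quadratic form lets positivity or vanishing of the form pass to the eigenvalues. *)
Lemma normalmx_eigenbasis (n : nat) (A : 'M[C]_n) : A \is normalmx ->
  exists (d : 'I_n -> C) (u : 'I_n -> 'cV[C]_n),
    [/\ forall i, d i = ((u i) ^t* *m A *m u i) 0 0,
        forall i, eigenvalue A (d i),
        A = \sum_i d i *: ketbra (u i)
      & \sum_i ketbra (u i) = 1%:M].
Proof.
move=> /orthomx_spectralP; set P := spectralmx A; set s := spectral_diag A.
have Pu : P \is unitarymx by exact: spectral_unitarymx.
rewrite invmx_unitary // => Adef.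
have PPt : P *m P ^t* = 1%:M by apply/unitarymxP.
have PtP : P ^t* *m P = 1%:M by apply: mulmx1C.
have PAe i : row i P *m A = s 0 i *: row i P.
  rewrite -row_mul Adef !mulmxA PPt mul1mx row_mul.
  by rewrite row_diag_mx -scalemxAl -rowE.
have rowPt i : row i P *m (row i P) ^t* = 1%:M.
  have /matrixP /(_ i i) := PPt; rewrite !mxE eqxx => PPti.
  apply/matrixP => j k; rewrite !ord1 !mxE eqxx -[RHS]PPti.
  by apply: eq_bigr => l _; rewrite !mxE.
(* A general [t] serves twice: [t = s] yields [A], and constant [1] yields the resolution of the
   identity. *)
have sum_ketbra (t : 'rV[C]_n) :
    \sum_i t 0 i *: ketbra ((row i P) ^t*) = P ^t* *m diag_mx t *m P.
  apply/matrixP => j k; rewrite mul_mx_diag summxE !mxE.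
  apply: eq_bigr => i _; rewrite /ketbra trmxCK !mxE big_ord1 !mxE.
  by rewrite mulrCA mulrA.
exists (fun i => s 0 i), (fun i => (row i P) ^t*); split.
- move=> i; rewrite trmxCK PAe -scalemxAl rowPt.
  by rewrite !mxE eqxx mulr1.
(* [eigenvalue] asks for a row eigenvector; [row i P] is nonzero because it has norm 1. *)
- move=> i; apply/eigenvalueP; exists (row i P); first exact: PAe.
  apply/eqP => r0; have := rowPt i; rewrite r0 mul0mx => /matrixP /(_ 0 0).
  by rewrite !mxE eqxx => /eqP; rewrite eq_sym oner_eq0.
- by rewrite sum_ketbra.
- have := sum_ketbra (const_mx 1); rewrite diag_const_mx mulmx1 PtP => <-.
  by apply: eq_bigr => i _; rewrite mxE scale1r.
Qed.

Lemma psdmx_hermitian (n : nat) (A : 'M[C]_n) : psdmx A -> A ^t* = A.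
Proof.
move=> Apos; pose B := A - A ^t*.
(* A - A^* is skew-adjoint, hence normal, with vanishing quadratic form. *)
have Bt : B ^t* = - B.
  by rewrite /B linearB /= map_mxB trmxCK opprB.
have /normalmx_eigenbasis [d [u [dE _ BE _]]] : B \is normalmx.
  by apply/normalmxP; rewrite Bt mulmxN mulNmx.
suff : B = 0 by move=> /eqP; rewrite subr_eq0 => /eqP.
rewrite BE big1 // => i _; rewrite dE /B mulmxBr mulmxBl.
set a := u i ^t* *m A *m u i.
have -> : u i ^t* *m A ^t* *m u i = a ^t*.
  by rewrite !trmxC_mul trmxCK mulmxA.
(* A nonnegative complex number is real, so the eigenvalue [a - a ^t*] of [B] vanishes. *)
have aR : Num.conj (a 0 0) = a 0 0 by apply/CrealP/ger0_real/Apos.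
by move: a aR => a aR; rewrite !mxE aR subrr scale0r.
Qed.

Lemma psdmx_eigenbasis (n : nat) (A : 'M[C]_n) : psdmx A ->
  exists (d : 'I_n -> C) (u : 'I_n -> 'cV[C]_n),
    [/\ forall i, 0 <= d i,
        forall i, eigenvalue A (d i),
        A = \sum_i d i *: ketbra (u i)
      & \sum_i ketbra (u i) = 1%:M].
Proof.
move=> Apos; have /normalmx_eigenbasis [d [u [dE eig AE uE]]] : A \is normalmx.
  by apply/normalmxP; rewrite psdmx_hermitian.
by exists d, u; split=> // i; rewrite dE.
Qed.

(** Expanding [B] in its eigenbasis turns the trace into a nonnegative combination of values of the
    quadratic form of [A]. *)
Lemma mxtrace_mul_psd_ge0 (n : nat) (A B : 'M[C]_n) :
  psdmx A -> psdmx B -> 0 <= \tr (A *m B).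
Proof.
move=> Apos /psdmx_eigenbasis [d [u [d_ge0 _ -> _]]].
rewrite mulmx_sumr linear_sum /=; apply: sumr_ge0 => i _.
by rewrite -scalemxAr mxtraceZ mxtrace_ketbra mulr_ge0.
Qed.

(** Both [A] and the identity in [a = a * \tr (1%:M *m ketbra v)] are expanded over the same
    eigenbasis; the terms compare one by one, with nonnegative weights. *)
Lemma largest_eigenvalue_ge (n : nat) (A : 'M[C]_n) (a : C) (v : 'cV[C]_n) :
  psdmx A -> largest_eigenvalue A a -> unit_vector v ->
  \tr (A *m ketbra v) <= a.
Proof.
move=> /psdmx_eigenbasis [d [u [_ eig AE uE]]] [_ amax] v1.
have <- : a * \tr (1%:M *m ketbra v) = a.
  by rewrite mxtrace_ketbra mulmx1 v1 mulr1.
rewrite AE -uE !mulmx_suml !linear_sum mulr_sumr /=; apply: ler_sum => i _.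
rewrite -scalemxAl mxtraceZ ler_wpM2r ?amax //.
by apply: mxtrace_mul_psd_ge0; apply: psdmx_ketbra.
Qed.

Lemma completely_positive_psdmx (n m : nat) (E : 'M[C]_n -> 'M[C]_m)
    (A : 'M[C]_n) : completely_positive E -> psdmx A -> psdmx (E A).
Proof.
move=> Ecp Apos.
(* The ampliation with k = 1, compressed by the unitary B. *)
pose B p : 'M[C]_(p, \sum_(i < 1) p) := \mxrow_(i < 1) 1%:M.
have Bt p : (B p) ^t* = \mxcol_(i < 1) 1%:M.
  rewrite tr_mxrow; apply/matrixP => i j; rewrite !mxE.
  by rewrite rmorph_nat eq_sym.
have BAB p (D : 'M[C]_p) : (B p) ^t* *m D *m B p = \mxblock_(i < 1, j < 1) D.
  rewrite Bt mxcol_mul mul_mxcol_mxrow.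
  by apply: eq_mxblock => i j; rewrite mul1mx mulmx1.
have BBt p : B p *m (B p) ^t* = 1%:M.
  by rewrite Bt mul_mxrow_mxcol big_ord1 mulmx1.
have := Ecp 1%N _ (psdmx_congr _ _ _ (B n) Apos).
have -> : ampliation E ((B n) ^t* *m A *m B n) = (B m) ^t* *m E A *m B m.
  by rewrite !BAB; apply: eq_mxblock => i j; rewrite mxblockK.
move=> /(psdmx_congr _ _ _ ((B m) ^t*)).
by rewrite trmxCK !mulmxA BBt mul1mx -mulmxA BBt mulmx1.
Qed.

End PositiveMatrices.

Section Channels.
Context {R : realType} {X : finType} {n m : nat}.
Local Notation C := R[i].
Variable E : X -> {linear 'M[C]_n -> 'M[C]_m}.
Hypothesis E_channel : forall x, quantum_channel (E x).

(** Duality makes the objective for a fixed POVM a linear functional of the state, which links step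
    (A) to the eigenvalue problem of step (B). *)
Lemma objective_pullback (rho : 'M[C]_n) (M : X -> 'M[C]_m) :
  objective E rho M = \tr (pullback E M *m rho).
Proof.
rewrite /objective /pullback mulmx_suml linear_sum /=; apply: eq_bigr => x _.
by rewrite mxtrace_mulC; apply: (adjointP (E x) _).2.
Qed.

Lemma psdmx_pullback (M : X -> 'M[C]_m) :
  (forall x, psdmx (M x)) -> psdmx (pullback E M).
Proof.
move=> Mpos v; rewrite -mxtrace_ketbra -objective_pullback.
apply: sumr_ge0 => x _; apply: mxtrace_mul_psd_ge0 => //.
apply: completely_positive_psdmx; first exact: (E_channel x).1.
exact: psdmx_ketbra.
Qed.

Lemma objective_le_card (M : X -> 'M[C]_m) (v : 'cV[C]_n) :
  povm M -> unit_vector v -> objective E (ketbra v) M <= #|X|%:R.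
Proof.
move=> [Mpos M1] v1.
rewrite -sumr_const; apply: ler_sum => x _.
have [Ecp Etp] := E_channel x.
(* The unit is split over all outcomes [y]; the term [y = x] is the one to bound, and the others are
   nonnegative. *)
have <- : \tr (E x (ketbra v) *m \sum_y M y) = 1.
  by rewrite M1 mulmx1 Etp -[ketbra v]mul1mx mxtrace_ketbra mulmx1.
rewrite mulmx_sumr linear_sum (bigD1 x) //= lerDl.
apply: sumr_ge0 => y _; apply: mxtrace_mul_psd_ge0 => //.
by apply: completely_positive_psdmx => //; apply: psdmx_ketbra.
Qed.

Context {rho : nat -> 'M[C]_n} {M : nat -> X -> 'M[C]_m} {V : nat -> R}.
Hypothesis run : alternating_run E rho M V.

Lemma run_value (k : nat) :
  objective E (rho k.+1) (M k.+1) = (V k.+1)%:C%C.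
Proof.
have [_ _ /(_ k) [_ _ [v [v1 ev ->]]]] := run.
by rewrite objective_pullback mxtrace_ketbra -mulmxA ev -scalemxAr mxE v1 mulr1.
Qed.

Lemma run_pure (k : nat) : pure_state (rho k).
Proof.
have [rho0 _ step] := run; case: k => [//|k].
by have [_ _ [v [v1 _ ->]]] := step k; exists v.
Qed.

Lemma run_nondecreasing (k : nat) : V k.+1 <= V k.+2.
Proof.
have [_ _ step] := run.
have [[Mk _] _ _] := step k; have [[[Mpos _] Mopt] top _] := step k.+1.
(* The old POVM [M k.+1] competes with [M k.+2], which is optimal for the state [rho k.+1]. *)
rewrite -lecR -run_value; apply: le_trans (Mopt _ Mk) _.
have [v v1 ->] := run_pure k.+1; rewrite objective_pullback.
by apply: largest_eigenvalue_ge top v1; apply: psdmx_pullback.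
Qed.

Lemma run_bounded (k : nat) : V k.+1 <= #|X|%:R.
Proof.
have [_ _ step] := run; have [[Mk _] _ _] := step k.
rewrite -lecR -run_value rmorph_nat; have [v v1 ->] := run_pure k.+1.
exact: objective_le_card.
Qed.

End Channels.

Theorem mainTheorem5 (R : realType) (X : finType) (n m : nat)
    (E : X -> {linear 'M[R[i]]_n -> 'M[R[i]]_m})
    (rho : nat -> 'M[R[i]]_n) (M : nat -> X -> 'M[R[i]]_m) (V : nat -> R) :
  (0 < #|X|)%N ->
  (0 < n)%N ->
  (forall x, quantum_channel (E x)) ->
  alternating_run E rho M V ->
  cvgn (fun k : nat => V k.+1) /\
  (forall eps : R, 0 < eps ->
     exists2 k : nat, (0 < k)%N & `|V k - V k.-1| < eps).
Proof.
move=> _ _ E_channel run.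
have Vcvg : cvgn (fun k : nat => V k.+1).
  apply: nondecreasing_is_cvgn.
    by apply/nondecreasing_seqP => k; exact: run_nondecreasing E_channel _ _ _ run k.
  exists #|X|%:R => _ [k _ <-]; exact: run_bounded E_channel _ _ _ run k.
split=> // eps eps0.
have /cvgrPdist_lt /(_ _ eps0) [N _ Nclose] :
    (fun k => V k.+2 - V k.+1) @ \oo --> (0 : R).
  rewrite -(subrr (limn (fun k => V k.+1))); apply: cvgB => //.
  by rewrite (cvg_shiftS (fun k => V k.+1)).
(* Entry [N] of the difference sequence is [V N.+2 - V N.+1], hence the index [N.+2]. *)
by exists N.+2 => //=; have := Nclose N (leqnn N); rewrite /= sub0r normrN.
Qed.
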